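(* Let $K$ be a field, $S=K[x_1,\ldots,x_n]$, and let $G$ be a finite simple graph with vertex set $\{x_1,\ldots,x_n\}$ and edge ideal $I(G)\subset S$. For every vector $\mathfrak{c}\in\mathbb{N}^n$, the ideal $(I(G)^{\delta_{\mathfrak{c}}(I(G))})_{\mathfrak{c}}$ is a polymatroidal ideal. In particular, it has linear quotients.
   Context: $\mathbb{N}$ is the set of nonnegative integers. The edge ideal of $G$ is $I(G)=(x_ix_j : x_ix_j\in E(G))\subset S$. For $\mathfrak{c}=(c_1,\ldots,c_n)\in\mathbb{N}^n$, a monomial $x_1^{a_1}\cdots x_n^{a_n}$ is $\mathfrak{c}$-bounded if $a_i\leq c_i$ for all $i$. For a monomial ideal $I\subset S$, $I_{\mathfrak{c}}$ denotes the ideal generated by all $\mathfrak{c}$-bounded monomials belonging to $I$. The number $\delta_{\mathfrak{c}}(I)$ is the largest integer $k$ such that $(I^k)_{\mathfrak{c}}\neq 0$ (with $I^0=S$). For a monomial ideal $I$, $\mathcal{G}(I)$ denotes its unique minimal set of monomial generators. A monomial ideal $I$ generated in a single degree is polymatroidal if for all $u=x_1^{a_1}\cdots x_n^{a_n}$ and $v=x_1^{b_1}\cdots x_n^{b_n}$ in $\mathcal{G}(I)$ and every $i$ with $a_i>b_i$, there exists $1\leq j\leq n$ with $a_j<b_j$ such that $x_j(u/x_i)\in\mathcal{G}(I)$. A monomial ideal $I$ has linear quotients if the elements of $\mathcal{G}(I)$ can be ordered as $u_1,\ldots,u_m$ so that for each $1\leq i<m$ the colon ideal $(u_1,\ldots,u_i):u_{i+1}$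 is generated by a subset of $\{x_1,\ldots,x_n\}$. *)

(* Defs.v *)
From HB Require Import structures.
From mathcomp Require Import all_boot all_order all_algebra.
From mathcomp Require Export mpoly.
From Stdlib Require Import ClassicalEpsilon.

Set Implicit Arguments.
Unset Strict Implicit.
Unset Printing Implicit Defensive.

Import GRing.Theory.
Local Open Scope ring_scope.

(* Ideals of S = {mpoly K[n]} are handled as Prop-valued predicates on S, and
   are compared extensionally.  Exponent vectors, and in particular the bound
   c in N^n, are elements of 'X_{1..n}; (m <= c)%MM is the componentwise
   order, so it says that the monomial 'X_[m] is c-bounded. *)

Section Ideals.
Variables (n : nat) (K : fieldType).
Implicit Types (I J A : {mpoly K[n]} -> Prop) (M : 'X_{1..n} -> Prop).

Definition ideal_eq I J : Prop := forall f, I f <-> J f.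

Definition ideal_gen A : {mpoly K[n]} -> Prop := fun f =>
  exists s : seq ({mpoly K[n]} * {mpoly K[n]}),
    (forall p, p \in s -> A p.2) /\ f = \sum_(p <- s) p.1 * p.2.

Definition ideal_mul I J : {mpoly K[n]} -> Prop :=
  ideal_gen (fun f => exists g h, [/\ I g, J h & f = g * h]).

Definition ideal_exp I (k : nat) : {mpoly K[n]} -> Prop :=
  iter k (ideal_mul I) (fun=> True).

Definition ideal_nonzero I : Prop := exists2 f, I f & f != 0.

Definition ideal_colon I (u : {mpoly K[n]}) : {mpoly K[n]} -> Prop :=
  fun f => I (f * u).

Definition monomial_gen M : {mpoly K[n]} -> Prop :=
  ideal_gen (fun f => exists2 m, M m & f = 'X_[m]).

Definition variable_gen (V : {set 'I_n}) : {mpoly K[n]} -> Prop :=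
  ideal_gen (fun f => exists2 i, i \in V & f = 'X_i).

Definition bounded_part (c : 'X_{1..n}) I : {mpoly K[n]} -> Prop :=
  monomial_gen (fun m => I 'X_[m] /\ (m <= c)%MM).

Definition is_delta (c : 'X_{1..n}) I (k : nat) : Prop :=
  ideal_nonzero (bounded_part c (ideal_exp I k)) /\
  forall l, ideal_nonzero (bounded_part c (ideal_exp I l)) -> (l <= k)%N.

(* Arbitrary when the maximum does not exist (e.g. for I = S); see
   [edge_ideal_deltaP] below for edge ideals. *)
Definition delta (c : 'X_{1..n}) I : nat :=
  epsilon (inhabits 0%N) (is_delta c I).

(* M is the set of exponents of the minimal monomial generating set of I; such
   an M exists only if I is a monomial ideal, and it is unique by
   [is_mingens_unique]. *)
Definition is_mingens I M : Prop :=
  ideal_eq I (monomial_gen M) /\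
  forall M' : 'X_{1..n} -> Prop,
    (forall m, M' m -> M m) -> ideal_eq I (monomial_gen M') ->
    forall m, M m -> M' m.

Definition polymatroidal I : Prop :=
  exists M : 'X_{1..n} -> Prop,
    [/\ is_mingens I M,
        exists d : nat, forall m, M m -> mdeg m = d
      & forall u v, M u -> M v -> forall i : 'I_n, (v i < u i)%N ->
          exists2 j : 'I_n, (u j < v j)%N & M (u - U_(i) + U_(j))%MM].

Definition linear_quotients I : Prop :=
  exists s : seq 'X_{1..n},
    [/\ uniq s,
        is_mingens I (fun m => m \in s)
      & forall i : nat, (0 < i < size s)%N ->
          exists V : {set 'I_n},
            ideal_eq
              (ideal_colon (monomial_gen (fun m => m \in take i s))
                           'X_[nth 0%MM s i])
              (variable_gen V)].

End Ideals.

Record simple_graph (n : nat) := SimpleGraph {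
  adj :> rel 'I_n;
  adj_sym : ssrbool.symmetric adj;
  adj_irr : irreflexive adj
}.

Definition edge_ideal (K : fieldType) (n : nat) (G : simple_graph n) :
    {mpoly K[n]} -> Prop :=
  ideal_gen (fun f => exists i j : 'I_n, G i j /\ f = 'X_i * 'X_j).

Section Facts.
Variables (n : nat) (K : fieldType).
Implicit Types (I A : {mpoly K[n]} -> Prop) (M : 'X_{1..n} -> Prop).

Lemma ideal_gen_supp A (Q : 'X_{1..n} -> Prop) (f : {mpoly K[n]}) :
  (forall m m', Q m -> Q (m' + m)%MM) ->
  (forall g m, A g -> m \in msupp g -> Q m) ->
  ideal_gen A f -> forall m, m \in msupp f -> Q m.
Proof.
move=> Qup QA [s [sA ->]] m /msupp_sum_le /flattenP[/= ms].
case/mapP=> p; rewrite mem_filter => /andP[_ ps] -> /msuppM_le.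
case/allpairsP=> -[m1 m2] /= [_ m2p ->].
exact/Qup/(QA p.2)/m2p/sA.
Qed.

Lemma monomial_gen_supp M (f : {mpoly K[n]}) m :
  monomial_gen M f -> m \in msupp f -> exists2 a, M a & (a <= m)%MM.
Proof.
move=> If; move: m; apply: (ideal_gen_supp _ _ If) => [m m' [a Ma am]|g m].
  by exists a => //; apply: lepm_trans am _; rewrite addmC lem_addr.
by case=> a Ma ->; rewrite msuppX inE => /eqP ->; exists a => //; apply: lepm_refl.
Qed.

Lemma ideal_gen_sub A (f g : {mpoly K[n]}) : A f -> ideal_gen A (g * f).
Proof.
move=> Af; exists [:: (g, f)]; split; last by rewrite big_seq1.
by move=> p; rewrite inE => /eqP ->.
Qed.

Lemma ideal_genW A B (f : {mpoly K[n]}) :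
  (forall g, A g -> ideal_gen B g) -> ideal_gen A f -> ideal_gen B f.
Proof.
move=> AB [s [sA ->]]; elim: s sA => [|p s IHs] sA.
  by exists [::]; rewrite !big_nil.
rewrite big_cons; have [q qs|s1 [s1B ->]] := IHs; first by apply: sA; rewrite inE qs orbT.
have [s2 [s2B ->]] : ideal_gen B p.2 by apply/AB/sA/mem_head.
exists ([seq (p.1 * q.1, q.2) | q <- s2] ++ s1); split.
  by move=> q; rewrite mem_cat => /orP[/mapP[r rs ->]|]; [exact: (s2B r rs) | exact: s1B].
rewrite big_cat big_map mulr_sumr; congr (_ + _).
by apply: eq_bigr => q _; rewrite mulrA.
Qed.

Lemma is_mingens_le I M a b : is_mingens I M ->
  M a -> M b -> (b <= a)%MM -> a = b.
Proof.
move=> [IM Mmin] Ma Mb ba; have [//|nab] := eqVneq a b.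
suff [] : M a /\ a <> a by [].
apply: (Mmin (fun m => M m /\ m <> a)) => // [m []//|f]; split.
  move/IM; apply: ideal_genW => _ [m Mm ->]; have [->|nma] := eqVneq m a.
    rewrite -[X in 'X_[X]](submK ba) mpolyXD; apply: ideal_gen_sub.
    by exists b => //; split=> // ba'; case/eqP: nab; rewrite ba'.
  rewrite -[X in ideal_gen _ X]mul1r; apply: ideal_gen_sub.
  by exists m => //; split=> //; apply/eqP.
move=> If; apply/IM; apply: ideal_genW If => _ [m [Mm _] ->].
by rewrite -[X in ideal_gen _ X]mul1r; apply: ideal_gen_sub; exists m.
Qed.

Lemma is_mingens_unique I M M' :
  is_mingens I M -> is_mingens I M' -> forall m, M m <-> M' m.
Proof.
suff W M1 M2 : is_mingens I M1 -> is_mingens I M2 -> forall m, M1 m -> M2 m.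
  by move=> hM hM' m; split; apply: W.
move=> h1 h2 m M1m.
have cover N1 N2 a : is_mingens I N1 -> is_mingens I N2 -> N1 a ->
    exists2 b, N2 b & (b <= a)%MM.
  move=> [g1 _] [g2 _] N1a; apply: (@monomial_gen_supp N2 'X_[a]); last first.
    by rewrite msuppX inE.
  apply/g2/g1; rewrite -[X in monomial_gen _ X]mul1r; apply: ideal_gen_sub.
  by exists a.
have [b M2b bm] := cover _ _ _ h1 h2 M1m.
have [a M1a ab] := cover _ _ _ h2 h1 M2b.
have ma := is_mingens_le h1 M1m M1a (lepm_trans ab bm).
suff -> : m = b by [].
by apply/mnmP => i; apply/eqP; rewrite eqn_leq {1}ma (mnm_lepP ab) (mnm_lepP bm).
Qed.

Lemma edge_ideal_exp_deg (G : simple_graph n) k (f : {mpoly K[n]}) m :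
  ideal_exp (edge_ideal (K := K) G) k f -> m \in msupp f -> (2 * k <= mdeg m)%N.
Proof.
have up d (m1 m2 : 'X_{1..n}) : (d <= mdeg m1 -> d <= mdeg (m2 + m1))%N.
  by move=> dm; rewrite mdegD (leq_trans dm) ?leq_addl.
elim: k f m => [|k IHk] f m; first by rewrite muln0.
move=> If; apply: (ideal_gen_supp (Q := fun m => is_true (2 * k.+1 <= mdeg m)%N) _ _ If).
  by move=> m1 m2; apply: up.
move=> _ m1 [g [h [Ig Ih ->]]] /msuppM_le/allpairsP[[m2 m3] /= [m2g m3h ->]].
rewrite mulnS mdegD leq_add ?(IHk h) //.
apply: (ideal_gen_supp (Q := fun m => is_true (2 <= mdeg m)%N) _ _ Ig) m2g.
  by move=> m4 m5; apply: up.
move=> _ m4 [i [j [_ ->]]].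
by rewrite -mpolyXD msuppX inE => /eqP ->; rewrite mdegD !mdeg1.
Qed.

Lemma edge_ideal_deltaP (G : simple_graph n) (c : 'X_{1..n}) :
  is_delta c (edge_ideal (K := K) G) (delta c (edge_ideal (K := K) G)).
Proof.
apply: epsilon_spec; set I := edge_ideal _.
pose P k := ideal_nonzero (bounded_part c (ideal_exp I k)).
have P0 : P 0%N.
  exists 1; last exact: oner_neq0.
  rewrite -[X in bounded_part _ _ X]mul1r; apply: ideal_gen_sub.
  exists 0%MM; last by rewrite mpolyX0.
  by split=> //; apply/mnm_lepP => i; rewrite mnm0E.
have Pbound k : P k -> (k <= mdeg c)%N.
  case=> f If; rewrite -msupp_eq0; case E: (msupp f) => [//|m s] _.
  have [|a [Ia /mnm_lepP ac] _] := monomial_gen_supp (m := m) If.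
    by rewrite E mem_head.
  have := edge_ideal_exp_deg (m := a) Ia; rewrite msuppX inE => /(_ (eqxx _)) ka.
  apply: (@leq_trans (2 * k)); first by rewrite leq_pmull.
  by apply: leq_trans ka _; rewrite !mdegE; apply: leq_sum => i _; apply: ac.
pose p k : bool := if excluded_middle_informative (P k) then true else false.
have pP k : reflect (P k) (p k).
  by rewrite /p; case: excluded_middle_informative => h; constructor.
have exp : exists k, p k by exists 0%N; apply/pP.
have bp k : p k -> (k <= mdeg c)%N by move/pP/Pbound.
by case: (ex_maxnP exp bp) => k /pP Pk kmax; exists k; split=> // l /pP /kmax.
Qed.

End Facts.

(* Main.v *)
(* The minimal generators of the ideal are the c-bounded products of k = delta
   edges, that is the degree vectors <= c of multigraphs with k edges supported
   on G.  If u and v are two of them and u_i > v_i, follow from i a walk that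
   alternates between edges of u and edges of v.  If it stops after an edge of
   v, at a vertex j with u_j < v_j, then exchanging the edges along the walk in
   u turns u into x_j u / x_i.  If it stops after an edge of u, at a vertex j,
   then exchanging them in v gives the c-bounded product x_i x_j v of k + 1
   edges, against the maximality of k.  Linear quotients hold for every
   polymatroidal ideal, the generators being listed in increasing
   lexicographic order. *)

Require Import Defs.
From mathcomp Require Import all_boot all_order all_algebra.
From mathcomp Require Import zify.
From Stdlib Require Import ClassicalEpsilon.

Import Order.POrderTheory Order.TotalTheory GRing.Theory.

(** * Products of edges and alternating walks *)

Section EdgeProducts.
Set Implicit Arguments.
Unset Strict Implicit.
Unset Printing Implicit Defensive.
Variables (n : nat) (G : simple_graph n).

(** A relation, since a monomial may factor into edges in several ways; edges may repeat. *)
Inductive edge_product : nat -> 'X_{1..n} -> Prop :=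
| EdgeProduct0 : edge_product 0 0%MM
| EdgeProductS k m i j : G i j -> edge_product k m ->
    edge_product k.+1 (U_(i) + U_(j) + m)%MM.

Lemma edge_product_eqS k m m' i j : G i j -> edge_product k m ->
  m' = (U_(i) + U_(j) + m)%MM -> edge_product k.+1 m'.
Proof. by move=> Gij Em ->; apply: EdgeProductS. Qed.

Lemma edge_product_mdeg k m : edge_product k m -> mdeg m = (2 * k)%N.
Proof.
elim=> [|{}k {}m i j _ _ IH]; first by rewrite mdeg0.
by rewrite !mdegD !mdeg1 IH mulnS.
Qed.

Lemma edge_product_split k m i : edge_product k m -> (0 < m i)%N ->
  exists k' j m', [/\ k = k'.+1, G i j, edge_product k' m'
                    & m = (U_(i) + U_(j) + m')%MM].
Proof.
elim=> [|{}k {}m a b Gab Em IH]; first by rewrite mnm0E.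
have [<- _|nai] := eqVneq a i; first by exists k, b, m.
have [<- _|nbi] := eqVneq b i.
  by exists k, a, m; split; rewrite // 1?adj_sym // [(U_(b) + _)%MM]addmC.
rewrite !mnmDE !mnm1E (negPf nai) (negPf nbi) /= => /IH.
case=> k' [j] [m'] [-> Gij Em' ->]; exists k'.+1, j, (U_(a) + U_(b) + m')%MM.
by split=> //; [apply: EdgeProductS | apply/mnmP=> x; rewrite !mnmDE; lia].
Qed.

(* The induction removes the first two edges (i,a), (a,b) of the alternating
   walk, which then goes on from b. *)
Lemma edge_product_exchange k l A B i :
  edge_product k A -> edge_product l B -> (B i < A i)%N ->
  (exists j A', [/\ (A j < B j)%N, edge_product k A'
                  & (A' + U_(i))%MM = (A + U_(j))%MM])
  \/ (exists2 j, (B j + (i == j) < A j)%N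
                 & edge_product l.+1 (B + U_(i) + U_(j))%MM).
Proof.
elim: k l A B i => [|k IH] l A B i EA EB ltBA.
  by inversion EA; subst; move: ltBA; rewrite mnm0E.
have [|k' [a] [A1 [[<-] Gia EA1 defA]]] := edge_product_split (i := i) EA.
  exact: leq_ltn_trans ltBA.
have nia : i != a by apply/eqP=> ia; move: Gia; rewrite ia adj_irr.
have [ltBAa|leABa] := ltnP (B a) (A a).
  right; exists a; first by rewrite (negPf nia) addn0.
  by apply: edge_product_eqS Gia EB _; rewrite [RHS]addmC addmA.
have Aa : (0 < A a)%N.
  by rewrite defA !mnmDE !mnm1E eqxx; lia.
have [|l' [b] [B1 [defl Gab EB1 defB]]] := edge_product_split (i := a) EB.
  exact: leq_trans leABa.
have nab : a != b by apply/eqP=> ab; move: Gab; rewrite ab adj_irr.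
have AE j : A j = ((i == j) + (a == j) + A1 j)%N by rewrite defA !mnmDE !mnm1E.
have BE j : B j = ((a == j) + (b == j) + B1 j)%N by rewrite defB !mnmDE !mnm1E.
have [ltABb|leBAb] := ltnP (A b) (B b).
  left; exists b, (U_(a) + U_(b) + A1)%MM; split=> //.
    exact: EdgeProductS.
  by rewrite defA; apply/mnmP=> x; rewrite !mnmDE; lia.
have [|[j] [A' [ltj EA' defA']]|[j ltj EB']] := IH l' A1 B1 b EA1 EB1.
(* The inequality needed at [b] holds: [B] loses a unit there, and [A] loses one only if [b = i],
   where [B i < A i] was strict. *)
- move: leBAb ltBA; rewrite !AE !BE !eqxx (negPf nab).
  have [<-|nib] := eqVneq i b; last by rewrite /=; lia.
  by rewrite eq_sym (negPf nia); lia.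
- left; exists j, (U_(a) + U_(b) + A')%MM; split; last first.
  + apply/mnmP=> x; have := congr1 (fun m : 'X_{1..n} => m x) defA'.
    by rewrite defA !mnmDE; lia.
  + exact: EdgeProductS.
  + move: ltBA ltj; rewrite !AE !BE.
    (* A walk ending at [j = i] would give [A1 i < B1 i], against [B i < A i]. *)
    have [<-|nij] := eqVneq i j; last by lia.
    by rewrite eqxx eq_sym (negPf nia); lia.
right; exists j; first by move: ltj; rewrite AE BE; lia.
subst l; apply: edge_product_eqS Gia EB' _.
by rewrite defB; apply/mnmP=> x; rewrite !mnmDE; lia.
Qed.

End EdgeProducts.

(** * Monomial ideals and linear quotients *)

Section MonomialIdeals.
Set Implicit Arguments.
Unset Strict Implicit.
Unset Printing Implicit Defensive.
Variables (n : nat) (K : fieldType).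
Implicit Types (I J A : {mpoly K[n]} -> Prop) (M : 'X_{1..n} -> Prop).
Local Open Scope ring_scope.

Lemma mem_ideal_gen A f : A f -> ideal_gen A f.
Proof. by move=> Af; rewrite -[f]mul1r; apply: ideal_gen_sub. Qed.

Lemma ideal_genM A f g : ideal_gen A f -> ideal_gen A (g * f).
Proof.
case=> s [sA ->]; exists [seq (g * p.1, p.2) | p <- s]; split.
  by move=> _ /mapP[p ps ->]; exact: (sA p).
by rewrite big_map mulr_sumr; apply: eq_bigr => p _; rewrite mulrA.
Qed.

Lemma ideal_gen_msupp A f :
  (forall m, m \in msupp f -> ideal_gen A 'X_[m]) -> ideal_gen A f.
Proof.
move=> fA; apply: (@ideal_genW _ _ (fun g => exists2 m, m \in msupp f & g = 'X_[m])).
  by move=> _ [m mf ->]; apply: fA.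
exists [seq ((f@_m)%:MP, 'X_[m]) | m <- msupp f]; split.
  by move=> _ /mapP[m mf ->]; exists m.
by rewrite big_map {1}[f]mpolyE; apply: eq_bigr => m _; rewrite mul_mpolyC.
Qed.

Lemma monomial_genX M a m : M a -> (a <= m)%MM -> monomial_gen (K := K) M 'X_[m].
Proof.
move=> Ma am; rewrite -(submK am) mpolyXD; apply: ideal_gen_sub.
by exists a.
Qed.

Lemma eq_monomial_gen M M' : (forall m, M m <-> M' m) ->
  ideal_eq (monomial_gen (K := K) M) (monomial_gen M').
Proof.
by move=> MM' f; split; apply: ideal_genW => _ [m /MM' Mm ->];
  apply: mem_ideal_gen; exists m.
Qed.

(** Divisibility between monomials of equal degree is equality, so no generator is redundant. *)
Lemma is_mingens_equigenerated I M d :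
  ideal_eq I (monomial_gen M) -> (forall m, M m -> mdeg m = d) ->
  is_mingens I M.
Proof.
move=> IM Md; split=> // M' M'M IM' m Mm.
have : monomial_gen (K := K) M' 'X_[m].
  by apply/IM'/IM/mem_ideal_gen; exists m.
move/monomial_gen_supp=> /(_ m); rewrite msuppX inE => /(_ (eqxx _)) [a M'a am].
suff -> : m = a by [].
have : mdeg (m - a)%MM = 0%N.
  by apply: (@addIn (mdeg a)); rewrite -mdegD submK // !Md //; apply: M'M.
by move/eqP; rewrite mdeg_eq0 => /eqP ma; rewrite -[LHS](submK am) ma add0m.
Qed.

(** Only finitely many monomials have degree [d], and excluded middle selects those in [M]. Within
    one degree [<%O] is the lexicographic order. *)
Lemma finite_mdeg_enum M d : (forall m, M m -> mdeg m = d) ->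
  exists s : seq 'X_{1..n},
    [/\ uniq s, sorted <%O s & forall m, M m <-> m \in s].
Proof.
move=> Md; pose p m : bool := if excluded_middle_informative (M m) then true else false.
have pP m : reflect (M m) (p m).
  by rewrite /p; case: excluded_middle_informative => h; constructor.
pose s := [seq m <- [seq bmnm m | m : 'X_{1..n < d.+1}] | p m].
have s_uniq : uniq s.
  by rewrite filter_uniq // map_inj_uniq ?enum_uniq //; apply: val_inj.
exists (sort <=%O s); split; first by rewrite sort_uniq.
- rewrite lt_sorted_uniq_le sort_uniq s_uniq.
  exact/sort_sorted/le_total.
- move=> m; rewrite mem_sort mem_filter; split=> [Mm|/andP[/pP]//].
  have md : (mdeg m < d.+1)%N by rewrite (Md m Mm).
  apply/andP; split; first exact/pP.
  by apply/mapP; exists (BMultinom md); rewrite ?mem_enum.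
Qed.

(* For an earlier generator v, let i be the first index with v_i != u_i, so that
   v_i < u_i.  The generator x_j u / x_i given by the exchange property is again
   earlier than u, because j > i, and x_j divides v / gcd(v, u). *)
Lemma polymatroidal_linear_quotients I : polymatroidal I -> linear_quotients I.
Proof.
case=> M [minM [d Md] exM].
have [s [s_uniq s_lt sM]] := finite_mdeg_enum Md.
exists s; split=> //.
  apply: (@is_mingens_equigenerated _ _ d) => [f|m /sM/Md //].
  by rewrite (minM.1 f); apply: eq_monomial_gen.
move=> i /andP[_ i_lt]; set u := nth _ _ _.
have us : u \in s by apply: mem_nth.
have takeP v : v \in s -> (v \in take i s) = (v < u)%O.
  move=> vs; rewrite in_take // -[i](index_uniq 0%MM i_lt s_uniq) -/u.
  have lt_index := sorted_ltn_index lt_trans s_lt.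
  apply/idP/idP; first exact: lt_index.
  apply: contraTT; rewrite -leqNgt leq_eqVlt.
  case/orP=> [/eqP uv|/(lt_index _ _ us vs)/lt_gtF->//].
  by rewrite -(nth_index 0%MM vs) -uv nth_index // ltxx.
(* This choice puts the variables into the colon ideal at once; the other inclusion rests on the
   exchange property. *)
exists [set j | has (fun v => (v <= u + U_(j))%MM) (take i s)] => f; split=> [fu|].
  apply: ideal_gen_msupp => m mf.
  have [|v vs vm] := monomial_gen_supp (m := (u + m)%MM) fu.
    by rewrite mcoeff_msupp mcoeffMX -mcoeff_msupp.
  have vs' := mem_take vs.
  have degE : mdeg v = mdeg u by rewrite !Md //; apply/sM.
  have /ltmcP-/(_ degE) [q eqq ltq] : (v < u)%O by rewrite -takeP.
  have [j ltj Mj] := exM _ _ ((sM u).2 us) ((sM v).2 vs') q ltq.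
  (* Since [v] divides the product of [u] and [m], and [u j < v j], the variable [x_j] divides
     [m]. *)
  have mj : (0 < m j)%N.
    by have := mnm_lepP vm j; rewrite mnmDE; lia.
  have jm : (U_(j) <= m)%MM.
    by apply/mnm_lepP=> x; rewrite mnm1E; have [<-|] := eqVneq.
  rewrite -(submK jm) mpolyXD; apply: ideal_gen_sub; exists j => //.
  rewrite inE; apply/hasP; exists (u - U_(q) + U_(j))%MM; last first.
    by apply/mnm_lepP=> x; rewrite !mnmDE mnmBE leq_add2r leq_subr.
  rewrite takeP; last exact/sM.
  have nqj : q != j by apply/eqP=> qj; move: ltj ltq; rewrite qj; lia.
  have ltqj : (q < j)%N.
    rewrite ltn_neqAle nqj leqNgt; apply/negP=> /eqq vj.
    by move: ltj; rewrite vj ltnn.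
  apply/ltmcP; first by rewrite !Md //; apply/sM.
  exists q => [x xq|]; rewrite mnmDE mnmBE !mnm1E.
    by rewrite -!val_eqE /= !gtn_eqF ?subn0 ?addn0 // (ltn_trans xq).
  by rewrite eqxx eq_sym (negPf nqj); lia.
move=> fV; rewrite /ideal_colon mulrC; move: fV => [t [tV ->]].
rewrite mulr_sumr.
apply: (@ideal_genW _ _ (fun g =>
    exists2 j, (exists2 v, v \in take i s & (v <= u + U_(j))%MM)
             & g = 'X_[u + U_(j)])).
  by move=> _ [j [v vs vj] ->]; apply: monomial_genX vj.
exists [seq (p.1, 'X_[u] * p.2) | p <- t]; split.
  move=> _ /mapP[p /tV [j jV pj] ->]; move: jV; rewrite inE => /hasP[v vs vj].
  by exists j; [exists v | rewrite pj mpolyXD].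
by rewrite big_map; apply: eq_bigr => p _; rewrite mulrCA.
Qed.

End MonomialIdeals.

(** * Bounded powers of the edge ideal *)

Section EdgeIdeal.
Set Implicit Arguments.
Unset Strict Implicit.
Unset Printing Implicit Defensive.
Variables (n : nat) (K : fieldType) (G : simple_graph n).
Local Open Scope ring_scope.

(** Each monomial of a product of polynomials is a product of monomials of the factors, so every
    factor [I] of the power contributes an edge. *)
Lemma edge_ideal_expX k m :
  ideal_exp (@edge_ideal K n G) k 'X_[m] <->
  exists2 a, edge_product G k a & (a <= m)%MM.
Proof.
split.
  suff W f : ideal_exp (@edge_ideal K n G) k f ->
      forall m, m \in msupp f -> exists2 a, edge_product G k a & (a <= m)%MM.
    by move/W; apply; rewrite msuppX inE.
  have up (P : 'X_{1..n} -> Prop) m1 m2 : (exists2 a, P a & (a <= m1)%MM) ->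
      exists2 a, P a & (a <= m2 + m1)%MM.
    by case=> a Pa am; exists a => //; apply: lepm_trans am _; rewrite addmC lem_addr.
  elim: k f => [|k IH] f.
    by move=> _ m' _; exists 0%MM;
      [apply: EdgeProduct0 | apply/mnm_lepP=> x; rewrite mnm0E].
  apply: ideal_gen_supp => [m1 m2|]; first exact: up.
  move=> _ m1 [g [h [Ig /IH Ih ->]]] /msuppM_le/allpairsP[[m2 m3] /= [m2g m3h ->]].
  have [b Eb bm] := Ih _ m3h.
  suff [_ [i [j [Gij ->]] am]] :
      exists2 a, (exists i j, G i j /\ a = (U_(i) + U_(j))%MM) & (a <= m2)%MM.
    exists (U_(i) + U_(j) + b)%MM; first exact: EdgeProductS.
    by apply/mnm_lepP=> x; rewrite [leqLHS]mnmDE [leqRHS]mnmDE leq_add //;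
      apply/mnm_lepP.
  move: m2 m2g; apply: (ideal_gen_supp _ _ Ig) => [m1' m2|]; first exact: up.
  move=> _ m4 [i [j [Gij ->]]]; rewrite -mpolyXD msuppX inE => /eqP ->.
  by exists (U_(i) + U_(j))%MM; [exists i, j | apply: lepm_refl].
case=> a Ea am; rewrite -(submK am) mpolyXD; move: (m - a)%MM => b {m am}.
elim: Ea b => [//|{}k m i j Gij _ IH] b.
apply: ideal_genM; apply: mem_ideal_gen.
exists ('X_i * 'X_j), 'X_[m]; split; last by rewrite !mpolyXD.
  by apply: mem_ideal_gen; exists i, j.
by have := IH 0%MM; rewrite mpolyX0 mul1r.
Qed.

Definition bounded_edge_product c k m := edge_product G k m /\ (m <= c)%MM.

(** Divisors of a [c]-bounded monomial are [c]-bounded, in particular the edge product that divides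
    it. *)
Lemma bounded_edge_ideal_exp c k :
  ideal_eq (bounded_part c (ideal_exp (@edge_ideal K n G) k))
           (monomial_gen (bounded_edge_product c k)).
Proof.
move=> f; split; apply: ideal_genW => g [m].
  move=> [/edge_ideal_expX[a Ea am] mc] ->.
  apply: (@monomial_genX _ _ _ a) => //.
  by split=> //; apply: lepm_trans mc.
move=> [Em mc] ->; apply: mem_ideal_gen; exists m => //; split=> //.
by apply/edge_ideal_expX; exists m => //; apply: lepm_refl.
Qed.

(** The form in which maximality refutes the second outcome of the exchange. *)
Lemma edge_ideal_delta_max c l m :
  bounded_edge_product c l m -> (l <= delta c (@edge_ideal K n G))%N.
Proof.
move=> Em; apply: (edge_ideal_deltaP K G c).2.
exists 'X_[m]; last by rewrite -msupp_eq0 msuppX.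
by apply/bounded_edge_ideal_exp/mem_ideal_gen; exists m.
Qed.

Lemma edge_ideal_delta_polymatroidal c :
  let I := @edge_ideal K n G in
  polymatroidal (bounded_part c (ideal_exp I (delta c I))).
Proof.
move=> I; set k := delta c I.
have Md m : bounded_edge_product c k m -> mdeg m = (2 * k)%N.
  by case=> /edge_product_mdeg.
exists (bounded_edge_product c k); split; last 2 first.
- by exists (2 * k)%N.
- move=> u v [Eu uc] [Ev vc] i lti.
  have [[j [u' [ltj Eu' defu']]]|[j ltj Ev']] := edge_product_exchange Eu Ev lti.
    have ule x : (u' x + (i == x) = u x + (j == x))%N.
      by have := congr1 (fun m : 'X_{1..n} => m x) defu'; rewrite !mnmDE !mnm1E.
    (* The truncated subtraction is exact because [u i > 0]. *)
    exists j => //; have -> : (u - U_(i) + U_(j))%MM = u'.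
      apply/mnmP=> x; have := ule x; rewrite mnmDE mnmBE !mnm1E.
      by have [<-|] := eqVneq i x; lia.
    (* Only the exponent at [j] can grow, and [u j < v j <= c j]. *)
    split=> //; apply/mnm_lepP=> x; have := ule x; have := mnm_lepP uc x.
    have [<-|] := eqVneq j x; last by lia.
    by have := mnm_lepP vc j; lia.
  suff /edge_ideal_delta_max : bounded_edge_product c k.+1 (v + U_(i) + U_(j)).
    by rewrite ltnn.
  (* The term [(i == j)] of the exchange matters here: if [j = i], the exponent rises by two. *)
  split=> //; apply/mnm_lepP=> x; rewrite !mnmDE !mnm1E.
  have := mnm_lepP uc x; have := mnm_lepP vc x.
  have [<-|] := eqVneq j x; first by lia.
  by have [<-|] := eqVneq i x; lia.
exact: is_mingens_equigenerated (bounded_edge_ideal_exp c k) Md.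
Qed.

End EdgeIdeal.

Theorem theorem4p3 (K : fieldType) (n : nat) (G : simple_graph n)
    (c : 'X_{1..n}) :
  let I := @edge_ideal K n G in
  let J := bounded_part c (ideal_exp I (delta c I)) in
  polymatroidal J /\ linear_quotients J.
Proof.
move=> I J; have PJ : polymatroidal J by apply: edge_ideal_delta_polymatroidal.
by split=> //; apply: polymatroidal_linear_quotients.
Qed.
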